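(* (Worst-case tightness of the $\mathcal O(1/K_g)$ stepsize scaling.) Consider the fixed-local-update gradient-tracking scheme described in the context (no scaling matrix, one communication round per outer iteration) with exact averaging over a two-node network (mixing matrix $\tilde{\mathbf W}=\frac12\mathbf 1_2\mathbf 1_2^{\sf T}$). Let $L>0$. For every integer $K_g\ge 4$ and every stepsize $\alpha$ satisfying $$\alpha>\frac{8}{LK_g},$$ there exists a convex quadratic decentralized optimization problem $\min_{\mathbf z}\frac12(f_1(\mathbf z)+f_2(\mathbf z))$, with $L$-Lipschitz continuous local gradients $\nabla f_1,\nabla f_2$, such that the iterates generated by the scheme diverge geometrically from a suitable initialization. Consequently, any stepsize that guarantees convergence uniformly over this problem class must satisfy $\alpha=\mathcal O(1/(LK_g))$. Together with the sufficient stepsize bound of order $\mathcal O(1/K_g)$ for this type of scheme (recalled in the context), this shows that the dependence on $K_g$ is tight up to constant factors for this fixed-local-update scheme.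
   Context: Decentralized problem: each node $i\in\{1,\dots,n\}$ holds a local objective $f_i:\mathbb R^p\to\mathbb R$; the global objective is $F=\frac1n\sum_{i=1}^n f_i$, bounded below. In the lower-bound part $n=2$. ''Convex quadratic'' means that each $f_i$ is a convex polynomial of degree at most two (possibly identically zero). Scheme (stepsize $\alpha>0$, integer $K_g\ge1$ local updates, one communication round per outer iteration, mixing matrix $\tilde{\mathbf W}=[\tilde W_{ij}]$). Initialize $\mathbf x_i^0$ arbitrarily and $\mathbf v_i^0=\nabla f_i(\mathbf x_i^0)$ for every node $i$. At outer iteration $t=0,1,2,\dots$: set $\mathbf x_i^{t,0}=\mathbf x_i^t$, $\mathbf v_i^{t,0}=\mathbf v_i^t$. For $k=0,\dots,K_g-2$ set $\mathbf x_i^{t,k+1}=\mathbf x_i^{t,k}-\alpha\mathbf v_i^{t,k}$ and $\mathbf v_i^{t,k+1}=\mathbf v_i^{t,k}+\nabla f_i(\mathbf x_i^{t,k+1})-\nabla f_i(\mathbf x_i^{t,k})$. Then $\mathbf x_i^{t,K_g}=\mathbf x_i^{t,K_g-1}-\alpha\mathbf v_i^{t,K_g-1}$; $\mathbf x_i^{t+1}=\sum_j\tilde W_{ij}\mathbf x_j^{t,K_g}$; $\mathbf v_i^{t,K_g}=\mathbf v_i^{t,K_g-1}+\nabla f_i(\mathbf x_i^{t+1})-\nabla f_i(\mathbf x_i^{t,K_g-1})$; $\mathbf v_i^{t+1}=\sum_j\tilde W_{ij}\mathbf v_j^{t,K_g}$. ''Diverge geometrically'' means that the distance of the iterates from the minimizer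 of $F$ grows at least like $C r^t$ for some $C>0$ and $r>1$. Sufficient bound referred to in the claim. Let the $f_i$ be continuously differentiable (possibly nonconvex) with $L$-Lipschitz gradients and $F$ bounded below, and let the scheme run over a fixed, connected, undirected network of $n$ nodes with a symmetric doubly stochastic mixing matrix $\tilde{\mathbf W}$ (with $\tilde W_{ij}>0$ exactly when $j=i$ or $j$ is a neighbor of $i$), whose second largest eigenvalue magnitude is $\sigma\in(0,1)$. The paper shows that convergence is guaranteed (the minimum over $0\le t\le T$ of $\|\mathbf v^t\|^2+\|\mathbf v^t-\mathbf M\mathbf v^t\|^2+\|\mathbf x^t-\mathbf M\mathbf x^t\|^2$ is at most a constant over $T$, where $\mathbf x^t,\mathbf v^t$ stack the node variables and $\mathbf M=\frac1n\mathbf 1_n\mathbf 1_n^{\sf T}\otimes\mathbf I_p$) provided that $\alpha\le\frac{\sqrt3}{4LK_g}$ and $$\alpha<\frac{1}{\frac L2+16K_g\left(\frac L2+\frac{2L^2}{n(1-\sigma^2)}+\frac{64\sigma^2L^2}{n(1-\sigma^2)^3}+\frac{3n(1-\sigma^2)}{16}\right)}=\mathcal O\left(\frac1{K_g}\right).$$ *)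

(* Defs.v *)
From HB Require Import structures.
From mathcomp Require Import all_boot all_order all_algebra.
From mathcomp Require Import all_classical all_reals all_analysis.

Set Implicit Arguments.
Unset Strict Implicit.
Unset Printing Implicit Defensive.

Import Order.TTheory GRing.Theory Num.Theory.
Import numFieldNormedType.Exports.

Local Open Scope classical_set_scope.
Local Open Scope ring_scope.

(* The norm `|A| that the library puts on matrices is the sup norm; this is
   the Euclidean one (the Frobenius norm, for a stack of n vectors). *)
Definition l2norm (R : realType) (m n : nat) (A : 'M[R]_(m, n)) : R :=
  Num.sqrt (\sum_i \sum_j A i j ^+ 2).

Definition grad (R : realType) (p : nat) (f : 'rV[R]_p -> R) (x : 'rV[R]_p) :
    'rV[R]_p :=
  \row_(j < p) 'D_(delta_mx 0 j) f x.

Definition lipschitz_grad (R : realType) (p : nat) (L : R)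
    (f : 'rV[R]_p -> R) : Prop :=
  forall x y, l2norm (grad f x - grad f y) <= L * l2norm (x - y).

Definition global_obj (R : realType) (n p : nat) (f : 'I_n -> 'rV[R]_p -> R)
    (z : 'rV[R]_p) : R :=
  n%:R^-1 * \sum_(i < n) f i z.

Definition quadratic (R : realType) (p : nat) (f : 'rV[R]_p -> R) : Prop :=
  exists (A : 'M[R]_p) (b : 'cV[R]_p) (c : R), forall x,
    f x = (x *m A *m x^T) 0 0 + (x *m b) 0 0 + c.

Definition convex_quadratic_problem (R : realType) (n p : nat) (L : R)
    (f : 'I_n -> 'rV[R]_p -> R) : Prop :=
  [/\ forall i, quadratic (f i),
      forall i, convex_function [set: 'rV[R]_p] (f i),
      forall i, lipschitz_grad L (f i) &
      has_lbound (range (global_obj f))].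

Definition smooth_problem (R : realType) (n p : nat) (L : R)
    (f : 'I_n -> 'rV[R]_p -> R) : Prop :=
  [/\ forall i x, differentiable (f i) x,
      forall i, continuous (grad (f i)),
      forall i, lipschitz_grad L (f i) &
      has_lbound (range (global_obj f))].

(* The n local vectors of R^p are stacked as the rows of an n x p matrix, so
   that mixing by W (x) I_p is left multiplication by W. *)
Definition stacked_grad (R : realType) (n p : nat)
    (f : 'I_n -> 'rV[R]_p -> R) (x : 'M[R]_(n, p)) : 'M[R]_(n, p) :=
  \matrix_(i < n) grad (f i) (row i x).

Definition local_update (R : realType) (n p : nat)
    (f : 'I_n -> 'rV[R]_p -> R) (alpha : R)
    (s : 'M[R]_(n, p) * 'M[R]_(n, p)) : 'M[R]_(n, p) * 'M[R]_(n, p) :=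
  let x := s.1 - alpha *: s.2 in
  (x, s.2 + stacked_grad f x - stacked_grad f s.1).

(* The last of the Kg local steps evaluates the new gradient after the mixing
   of x, hence only Kg - 1 iterations of [local_update]. *)
Definition outer_update (R : realType) (n p : nat)
    (f : 'I_n -> 'rV[R]_p -> R) (W : 'M[R]_n) (Kg : nat) (alpha : R)
    (s : 'M[R]_(n, p) * 'M[R]_(n, p)) : 'M[R]_(n, p) * 'M[R]_(n, p) :=
  let s' := iter Kg.-1 (local_update f alpha) s in
  let x := W *m (s'.1 - alpha *: s'.2) in
  (x, W *m (s'.2 + stacked_grad f x - stacked_grad f s'.1)).

Definition iterates (R : realType) (n p : nat)
    (f : 'I_n -> 'rV[R]_p -> R) (W : 'M[R]_n) (Kg : nat) (alpha : R)
    (x0 : 'M[R]_(n, p)) (t : nat) : 'M[R]_(n, p) * 'M[R]_(n, p) :=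
  iter t (outer_update f W Kg alpha) (x0, stacked_grad f x0).

Definition averaging (R : realType) (n : nat) : 'M[R]_n := const_mx n%:R^-1.

Definition minimizer (R : realType) (p : nat) (F : 'rV[R]_p -> R)
    (z : 'rV[R]_p) : Prop :=
  forall y, F z <= F y.

Definition diverges_geometrically (R : realType) (n p : nat)
    (f : 'I_n -> 'rV[R]_p -> R) (s : nat -> 'M[R]_(n, p) * 'M[R]_(n, p)) :
    Prop :=
  exists z : 'rV[R]_p,
    [/\ minimizer (global_obj f) z,
        forall y, minimizer (global_obj f) y -> y = z &
        exists C r : R, [/\ 0 < C, 1 < r &
          forall t i, C * r ^+ t <= l2norm (row i (s t).1 - z)]].

Definition merit (R : realType) (n p : nat)
    (s : 'M[R]_(n, p) * 'M[R]_(n, p)) : R :=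
  l2norm s.2 ^+ 2 + l2norm (s.2 - averaging R n *m s.2) ^+ 2
  + l2norm (s.1 - averaging R n *m s.1) ^+ 2.

(* min_(t <= T) merit (s t) <= C / T *)
Definition merit_rate (R : realType) (n p : nat)
    (f : 'I_n -> 'rV[R]_p -> R) (s : nat -> 'M[R]_(n, p) * 'M[R]_(n, p)) :
    Prop :=
  exists C : R, forall T, (0 < T)%N ->
    exists2 t, (t <= T)%N & merit (s t) <= C / T%:R.

Definition minimizer_cvg (R : realType) (n p : nat)
    (f : 'I_n -> 'rV[R]_p -> R) (s : nat -> 'M[R]_(n, p) * 'M[R]_(n, p)) :
    Prop :=
  exists2 z : 'rV[R]_p, minimizer (global_obj f) z &
    forall i, (fun t => l2norm (row i (s t).1 - z)) @ \oo --> (0 : R).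

(* Convergence, in the sense [conv], for every problem of the class [P] and
   every initialization. *)
Definition guarantees (R : realType) (n p : nat)
    (conv : ('I_n -> 'rV[R]_p -> R) ->
            (nat -> 'M[R]_(n, p) * 'M[R]_(n, p)) -> Prop)
    (P : ('I_n -> 'rV[R]_p -> R) -> Prop)
    (W : 'M[R]_n) (Kg : nat) (alpha : R) : Prop :=
  forall f, P f -> forall x0, conv f (iterates f W Kg alpha x0).

(* Mixing matrices of a connected undirected network without self-loops. *)
Definition mixing_matrix (R : realType) (n : nat) (W : 'M[R]_n) : Prop :=
  exists e : rel 'I_n,
    [/\ symmetric e, irreflexive e & forall i j, connect e i j] /\
    [/\ W^T = W, forall i j, 0 <= W i j,
        forall i, \sum_j W i j = 1 &
        forall i j, (0 < W i j) = (i == j) || e i j].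

(* Eigenvalues are listed with multiplicity and by nonincreasing magnitude. *)
Definition second_eigenvalue_magnitude (R : realType) (n : nat)
    (W : 'M[R]_n) (sigma : R) : Prop :=
  exists s : seq R,
    [/\ char_poly W = \prod_(l <- s) ('X - l%:P),
        sorted (fun a b => `|b| <= `|a|) s &
        sigma = `|nth 0 s 1|].

Definition stepsize_bound (R : realType) (L : R) (n : nat) (sigma : R)
    (Kg : nat) (alpha : R) : Prop :=
  alpha <= Num.sqrt 3 / (4 * L * Kg%:R) /\
  alpha < 1 / (L / 2 + 16 * Kg%:R *
    (L / 2 + 2 * L ^+ 2 / (n%:R * (1 - sigma ^+ 2))
     + 64 * sigma ^+ 2 * L ^+ 2 / (n%:R * (1 - sigma ^+ 2) ^+ 3)
     + 3 * n%:R * (1 - sigma ^+ 2) / 16)).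

Definition sufficient_stepsize_bound (R : realType) : Prop :=
  forall (L : R) (n p : nat) (W : 'M[R]_n) (sigma : R) (Kg : nat) (alpha : R),
    0 < L -> (0 < p)%N -> (0 < Kg)%N -> 0 < alpha ->
    mixing_matrix W -> second_eigenvalue_magnitude W sigma ->
    0 < sigma < 1 ->
    stepsize_bound L n sigma Kg alpha ->
    guarantees (@merit_rate R n p) (smooth_problem L) W Kg alpha.

(* Over the two-node networks with mixing matrix in [Ws], the order of
   magnitude of the guaranteed stepsizes is exactly 1 / Kg: stepsizes of that
   order suffice even for nonconvex objectives, and larger ones fail already
   for convex quadratic objectives. *)
Definition stepsize_scaling_tight (R : realType) (L : R)
    (Ws : set 'M[R]_2) : Prop :=
  exists c C : R, [/\ 0 < c, 0 < C & forall p, (0 < p)%N ->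
    (forall (Kg : nat) (alpha : R), (0 < Kg)%N ->
       0 < alpha -> alpha <= c / Kg%:R ->
       forall W, Ws W ->
         guarantees (@merit_rate R 2 p) (smooth_problem L) W Kg alpha) /\
    (forall (Kg : nat) (alpha : R), (4 <= Kg)%N -> 0 < alpha ->
       (forall W, Ws W ->
          guarantees (@merit_rate R 2 p) (convex_quadratic_problem L)
            W Kg alpha) ->
       alpha <= C / Kg%:R)].

(* Main.v *)
(** Let M be the averaging matrix. Since the tracker minus the stacked
    gradient is unchanged by local updates and averages to zero, from t = 1
    on all nodes hold a common x^t and the tracker g^t = grad F(x^t).

    Small stepsizes: if alpha * K * L <= 1/8, the K local steps move the
    stacked iterate by -alpha K g^t up to a quarter of that length, so F
    decreases by a multiple of alpha K |g^t|^2 at each outer iteration;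
    summing gives the rate.

    Large stepsizes: take f_i(z) = a_i |z|^2 / 2, for which x^(t+1) = rho
    x^t. If alpha L > 2, then a = (L, L) gives rho = (1 - alpha L)^K.
    Otherwise, a = (0, L) gives rho = 1 - alpha L K / 4 - (1 - (1 - alpha
    L)^K) / 4, which is below -1 as soon as alpha L K > 8: the flat node
    follows the frozen average gradient for K steps and overshoots.

    The assumed sufficient bound excludes second eigenvalue 0; for two nodes
    that case is exact averaging, covered by the first argument. *)
Require Import Defs.
From HB Require Import structures.
From mathcomp Require Import all_boot all_order all_algebra.
From mathcomp Require Import all_classical all_reals all_analysis.
From mathcomp Require Import ring lra.

Set Implicit Arguments.
Unset Strict Implicit.
Unset Printing Implicit Defensive.

Import Order.TTheory GRing.Theory Num.Theory.
Import numFieldNormedType.Exports.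

Local Open Scope classical_set_scope.
Local Open Scope ring_scope.

(** * Frobenius inner product and norm *)

Definition dotmx (R : realType) (m n : nat) (A B : 'M[R]_(m, n)) : R :=
  \tr (A *m B^T).

Section Frobenius.
Variables (R : realType) (m n : nat).
Implicit Types (A B C : 'M[R]_(m, n)) (a : R).

Lemma dotmxE A B : dotmx A B = \sum_i \sum_j A i j * B i j.
Proof.
by apply: eq_bigr => i _; rewrite mxE; apply: eq_bigr => j _; rewrite mxE.
Qed.

Lemma dotmxC A B : dotmx A B = dotmx B A.
Proof. by rewrite /dotmx -mxtrace_tr trmx_mul trmxK. Qed.

Lemma dotmxDl A B C : dotmx (A + B) C = dotmx A C + dotmx B C.
Proof. by rewrite /dotmx mulmxDl mxtraceD. Qed.

Lemma dotmxZl a A B : dotmx (a *: A) B = a * dotmx A B.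
Proof. by rewrite /dotmx -scalemxAl mxtraceZ. Qed.

Lemma dotmxNl A B : dotmx (- A) B = - dotmx A B.
Proof. by rewrite -scaleN1r dotmxZl mulN1r. Qed.

Lemma dotmxDr A B C : dotmx A (B + C) = dotmx A B + dotmx A C.
Proof. by rewrite dotmxC dotmxDl !(dotmxC A). Qed.

Lemma dotmxZr a A B : dotmx A (a *: B) = a * dotmx A B.
Proof. by rewrite dotmxC dotmxZl dotmxC. Qed.

Lemma dotmxNr A B : dotmx A (- B) = - dotmx A B.
Proof. by rewrite dotmxC dotmxNl dotmxC. Qed.

Lemma dotmx_sqr_ge0 A : 0 <= dotmx A A.
Proof.
by rewrite dotmxE; do 2 (apply: sumr_ge0 => ? _); rewrite -expr2 sqr_ge0.
Qed.

Lemma l2norm_sqr A : l2norm A ^+ 2 = dotmx A A.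
Proof.
have -> : l2norm A = Num.sqrt (dotmx A A); last first.
  by rewrite sqr_sqrtr ?dotmx_sqr_ge0.
by rewrite dotmxE.
Qed.

Lemma l2norm_ge0 A : 0 <= l2norm A.
Proof. exact: sqrtr_ge0. Qed.

Lemma l2norm_eq0 A : l2norm A = 0 -> A = 0.
Proof.
move=> A0; have := l2norm_sqr A; rewrite A0 expr0n /= dotmxE => /esym/eqP.
rewrite psumr_eq0 => [|i _]; last first.
  by apply: sumr_ge0 => j _; rewrite -expr2 sqr_ge0.
move=> /allP/= h; apply/matrixP => i j; rewrite mxE.
have := h i (mem_index_enum i).
rewrite psumr_eq0 => [|k _]; last by rewrite -expr2 sqr_ge0.
by move=> /allP/(_ j (mem_index_enum j))/=; rewrite mulf_eq0 orbb => /eqP.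
Qed.

Lemma l2norm0 : l2norm (0 : 'M[R]_(m, n)) = 0.
Proof.
by apply/eqP; rewrite -sqrf_eq0 l2norm_sqr -(scale0r 0) dotmxZl mul0r.
Qed.

Lemma dotmx0l A : dotmx 0 A = 0.
Proof. by rewrite -(scale0r A) dotmxZl mul0r. Qed.

(** Cauchy-Schwarz: expanding the square of [l2norm B *: A - l2norm A *: B] gives the bound
    multiplied by [l2norm A * l2norm B], which is cancelled once the zero cases are set aside. *)
Lemma dotmx_le A B : dotmx A B <= l2norm A * l2norm B.
Proof.
have [A0|A0] := eqVneq (l2norm A) 0.
  by rewrite (l2norm_eq0 A0) l2norm0 dotmx0l mul0r.
have [B0|B0] := eqVneq (l2norm B) 0.
  by rewrite (l2norm_eq0 B0) dotmxC l2norm0 dotmx0l mulr0.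
have ab0 : 0 < l2norm A * l2norm B.
  by rewrite mulr_gt0 // lt0r ?A0 ?B0 l2norm_ge0.
rewrite -(ler_pM2l ab0).
have := dotmx_sqr_ge0 (l2norm B *: A - l2norm A *: B).
rewrite !(dotmxDl, dotmxDr, dotmxNl, dotmxNr, dotmxZl, dotmxZr) -!l2norm_sqr.
rewrite (dotmxC B A); lra.
Qed.

Lemma l2normZ a A : l2norm (a *: A) = `|a| * l2norm A.
Proof.
apply/eqP; rewrite -(@eqrXn2 _ 2) ?l2norm_ge0 ?mulr_ge0 ?l2norm_ge0 //.
by rewrite exprMn !l2norm_sqr dotmxZl dotmxZr real_normK ?num_real // mulrA.
Qed.

Lemma l2normN A : l2norm (- A) = l2norm A.
Proof. by rewrite -scaleN1r l2normZ normrN1 mul1r. Qed.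

Lemma l2normD_le A B : l2norm (A + B) <= l2norm A + l2norm B.
Proof.
rewrite -(@ler_pXn2r _ 2) ?nnegrE ?addr_ge0 ?l2norm_ge0 //.
rewrite l2norm_sqr dotmxDl !dotmxDr (dotmxC B A) sqrrD !l2norm_sqr.
have := dotmx_le A B; lra.
Qed.

End Frobenius.

Lemma dotmx_row (R : realType) (m n : nat) (A B : 'M[R]_(m, n)) :
  dotmx A B = \sum_i dotmx (row i A) (row i B).
Proof.
rewrite dotmxE; apply: eq_bigr => i _; rewrite dotmxE big_ord1.
by apply: eq_bigr => j _; rewrite !mxE.
Qed.

Lemma l2norm_row_le (R : realType) (m n : nat) (A : 'M[R]_(m, n)) i :
  l2norm (row i A) <= l2norm A.
Proof.
rewrite -(@ler_pXn2r _ 2) ?nnegrE ?l2norm_ge0 // !l2norm_sqr (dotmx_row A).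
rewrite (bigD1 i) //= lerDl; apply: sumr_ge0 => k _; exact: dotmx_sqr_ge0.
Qed.

(** * The averaging matrix as an orthogonal projection *)

Section Averaging.
Variables (R : realType) (n p : nat).
Hypothesis n_gt0 : (0 < n)%N.
Implicit Types A B : 'M[R]_(n, p).
Local Notation M := (averaging R n).

Lemma row_averaging A i : row i (M *m A) = n%:R^-1 *: \sum_j row j A.
Proof.
apply/rowP => k; rewrite !mxE summxE mulr_sumr.
by apply: eq_bigr => j _; rewrite !mxE.
Qed.

Lemma averaging_idem A : M *m (M *m A) = M *m A.
Proof.
apply/row_matrixP => i; rewrite row_averaging.
under eq_bigr => j _ do rewrite row_averaging.
rewrite sumr_const card_ord scalerMnl -(mulr_natr _^-1) mulVf ?scale1r.
  by rewrite row_averaging.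
by rewrite pnatr_eq0 -lt0n.
Qed.

Lemma dotmx_averaging A B : dotmx (M *m A) B = dotmx A (M *m B).
Proof.
rewrite /dotmx trmx_mul -mulmxA mxtrace_mulC mulmxA; congr (\tr (_ *m _)).
by apply/matrixP => i j; rewrite !mxE.
Qed.

(** Since M is symmetric and idempotent, |MA|^2 = <A, MA>, and Cauchy-Schwarz gives |MA|^2 <= |A|
    |MA|. *)
Lemma l2norm_averaging_le A : l2norm (M *m A) <= l2norm A.
Proof.
have [->|A0] := eqVneq (l2norm (M *m A)) 0; first exact: l2norm_ge0.
have A1 : 0 < l2norm (M *m A) by rewrite lt0r A0 l2norm_ge0.
rewrite -(ler_pM2r A1) -expr2 l2norm_sqr dotmx_averaging averaging_idem.
exact: dotmx_le.
Qed.

End Averaging.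

(** * The descent inequality for Lipschitz gradients *)

Section Descent.
Variables (R : realType) (p : nat) (L : R) (f : 'rV[R]_p -> R).
Hypothesis L_ge0 : 0 <= L.
Hypothesis f_diff : forall x, differentiable f x.
Hypothesis f_lip : lipschitz_grad L f.

Lemma derive_dotmx_grad x v : 'D_v f x = dotmx (grad f x) v.
Proof.
rewrite dotmxE big_ord1 deriveE // {1}(row_sum_delta v) linear_sum.
apply: eq_bigr => j _; rewrite linearZ /= mxE deriveE //.
by rewrite mulrC.
Qed.

Lemma is_derive_line x v (s : R) :
  is_derive s 1 (fun s : R => f (x + s *: v)) (dotmx (grad f (x + s *: v)) v).
Proof.
have E : (fun h : R => h^-1 *:
    (((fun s : R => f (x + s *: v)) \o shift s) (h *: 1) - f (x + s *: v))) =
  (fun h : R => h^-1 *: ((f \o shift (x + s *: v)) (h *: v) - f (x + s *: v))).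
  apply/funext => h /=; congr (_ *: (f _ - _)).
  by rewrite [h%:A]mulr1 scalerDl addrCA.
have D := diff_derivable (v := v) (f_diff (x + s *: v)).
apply: DeriveDef; first by rewrite /derivable E.
by rewrite -derive_dotmx_grad /derive E.
Qed.

(** The mean value theorem on the segment replaces the usual integral: the gradient at the
    intermediate point differs from that at x by at most L |d|. This costs the constant L in place
    of L/2, which the stepsize condition absorbs. *)
Lemma smooth_descent x d :
  f (x + d) <= f x + dotmx (grad f x) d + L * l2norm d ^+ 2.
Proof.
have dr (s : R) : s \in `[0, 1] -> derivable (fun s : R => f (x + s *: d)) s 1.
  by move=> _; exact: (@ex_derive _ _ _ _ _ _ _ (is_derive_line x d s)).
have [c c01] := MVT_segment (ler01 : (0 : R) <= 1)
  (fun s _ => is_derive_line x d s) (derivable_within_continuous dr).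
rewrite scale1r scale0r addr0 subr0 mulr1 => /eqP.
rewrite subr_eq => /eqP ->; rewrite addrC -addrA lerD2l.
rewrite -lerBlDl -dotmxNl -dotmxDl; apply: (le_trans (dotmx_le _ _)).
rewrite expr2 mulrA ler_wpM2r ?l2norm_ge0 //; apply: (le_trans (f_lip _ _)).
move: c01; rewrite in_itv /= => /andP[c0 c1].
rewrite addrC addKr l2normZ ger0_norm // ler_wpM2l //.
by rewrite ler_piMl ?l2norm_ge0.
Qed.

End Descent.

(** * Invariants of gradient tracking *)

Section Tracking.
Variables (R : realType) (n p : nat) (f : 'I_n -> 'rV[R]_p -> R) (alpha : R).
Implicit Types s : 'M[R]_(n, p) * 'M[R]_(n, p).
Local Notation M := (averaging R n).

Lemma iter_local_update_tracking k s :
  let s' := iter k (local_update f alpha) s in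
  s'.2 - stacked_grad f s'.1 = s.2 - stacked_grad f s.1.
Proof.
elim: k => //= k <-; set s' := iter _ _ _.
by rewrite addrAC addrK.
Qed.

(** The position after K - 1 local steps and a last unfinished one is that of K full local steps, so
    positions can be studied with [iter K]. The tracker formula follows from the invariance of the
    gap between tracker and gradient. *)
Lemma outer_updateE K s : (0 < K)%N ->
  let s' := outer_update f M K alpha s in
  s'.1 = M *m (iter K (local_update f alpha) s).1 /\
  s'.2 = M *m (s.2 - stacked_grad f s.1) + M *m stacked_grad f s'.1.
Proof.
case: K => // K _; split=> //=.
by rewrite -mulmxDr addrAC iter_local_update_tracking.
Qed.

(** The second equation makes every row of the tracker the gradient of the global objective at the
    common point. *)
Definition consensual s :=
  s.1 = M *m s.1 /\ s.2 = M *m stacked_grad f s.1.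

Lemma iterates_consensual K x0 t : (0 < n)%N -> (0 < K)%N ->
  consensual (iterates f M K alpha x0 t.+1).
Proof.
move=> n0 K0.
(* The averaged gap vanishes at first by the initialization. After an outer update the gap is M G -
   G, with G the new stacked gradient, and M kills it by idempotence. *)
have E t' : M *m ((iterates f M K alpha x0 t').2
    - stacked_grad f (iterates f M K alpha x0 t').1) = 0.
  elim: t' => [|t' IH]; first by rewrite subrr mulmx0.
  have [_ ->] := outer_updateE (iterates f M K alpha x0 t') K0.
  by rewrite IH add0r mulmxBr averaging_idem // subrr.
have [E1 E2] := outer_updateE (iterates f M K alpha x0 t) K0.
split; first by rewrite [LHS]E1 [in RHS]E1 averaging_idem.
by rewrite [LHS]E2 E add0r.
Qed.

Lemma merit_consensual s : (0 < n)%N -> consensual s ->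
  merit s = l2norm s.2 ^+ 2.
Proof.
move=> n0 [E1 E2]; rewrite /merit.
have -> : M *m s.2 = s.2 by rewrite E2 averaging_idem.
rewrite -E1 !subrr !l2norm0.
by rewrite expr0n !addr0.
Qed.

End Tracking.

(** * Convergence under exact averaging with small stepsizes *)

Section Convergence.
Variables (R : realType) (n p : nat) (f : 'I_n -> 'rV[R]_p -> R).
Variables (L alpha : R) (K : nat).
Hypotheses (n_gt0 : (0 < n)%N) (K_gt0 : (0 < K)%N).
Hypotheses (L_gt0 : 0 < L) (alpha_gt0 : 0 < alpha).
Hypothesis stepsize : alpha * L * K%:R <= 8^-1.
Hypothesis f_smooth : smooth_problem L f.
Implicit Types (s : 'M[R]_(n, p) * 'M[R]_(n, p)) (x d : 'M[R]_(n, p)).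
Local Notation M := (averaging R n).

Definition stacked_obj x : R := \sum_i f i (row i x).

Lemma row_stacked_grad x i : row i (stacked_grad f x) = grad (f i) (row i x).
Proof. by rewrite rowK. Qed.

Lemma stacked_grad_lip x d :
  l2norm (stacked_grad f x - stacked_grad f d) <= L * l2norm (x - d).
Proof.
rewrite -(@ler_pXn2r _ 2) ?nnegrE ?mulr_ge0 ?l2norm_ge0 ?(ltW L_gt0) //.
rewrite exprMn !l2norm_sqr !(@dotmx_row _ n) mulr_sumr. apply: ler_sum => i _.
rewrite -!l2norm_sqr -exprMn.
rewrite ler_pXn2r ?nnegrE ?mulr_ge0 ?l2norm_ge0 ?(ltW L_gt0) //.
by rewrite !raddfB /= !row_stacked_grad; case: f_smooth => _ _ + _; apply.
Qed.

Lemma stacked_descent x d :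
  stacked_obj (x + d) <=
  stacked_obj x + dotmx (stacked_grad f x) d + L * l2norm d ^+ 2.
Proof.
rewrite l2norm_sqr !(@dotmx_row _ n) mulr_sumr -!big_split /=.
apply: ler_sum => i _; rewrite row_stacked_grad -l2norm_sqr raddfD /=.
by case: f_smooth => fd _ fl _; apply: smooth_descent => //; exact: ltW.
Qed.

Lemma local_drift s k : (k <= K)%N ->
  l2norm ((iter k (local_update f alpha) s).1 - s.1 + (alpha * k%:R) *: s.2)
    <= alpha * k%:R * l2norm s.2 / 4.
Proof.
elim: k => [|k IH] kK.
  by rewrite subrr mulr0 scale0r addr0 l2norm0 !mul0r.
have {}IH := IH (ltnW kK).
have := iter_local_update_tracking f alpha k s.
rewrite iterS; move: IH; set y := iter _ _ _ => /= IH /eqP.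
rewrite subr_eq => /eqP Ey.
have V0 := l2norm_ge0 s.2.
have ak0 : 0 <= alpha * k%:R by rewrite mulr_ge0 // ltW.
have yd : l2norm (y.1 - s.1) <= alpha * k%:R * l2norm s.2 * (5 / 4).
  rewrite -[_ - _](addrK ((alpha * k%:R) *: s.2)).
  apply: (le_trans (l2normD_le _ _)).
  by rewrite l2normN l2normZ ger0_norm //; lra.
have gd : l2norm (stacked_grad f y.1 - stacked_grad f s.1) <= l2norm s.2 / 4.
  apply: (le_trans (stacked_grad_lip _ _)).
  have ?: alpha * L * k%:R <= 8^-1.
    apply: le_trans stepsize; rewrite ler_wpM2l ?ler_nat ?(ltnW kK) //.
    by rewrite mulr_ge0 ?ltW.
  have := ler_wpM2l (ltW L_gt0) yd; nra.
have -> : y.1 - alpha *: y.2 - s.1 + (alpha * k.+1%:R) *: s.2 =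
    (y.1 - s.1 + (alpha * k%:R) *: s.2)
    - alpha *: (stacked_grad f y.1 - stacked_grad f s.1).
  rewrite Ey -natr1; apply/matrixP => i j; rewrite !mxE; ring.
apply: (le_trans (l2normD_le _ _)).
rewrite l2normN l2normZ ger0_norm ?(ltW alpha_gt0) // -natr1.
have := ler_wpM2l (ltW alpha_gt0) gd; lra.
Qed.

(** With b = alpha K and V = |s.2|, the linear term of the descent inequality is at most -(3/4) b
    V^2, and the quadratic one at most (25/16) L b^2 V^2 <= b V^2 / 4, which leaves -b V^2 / 2. *)
Lemma outer_update_descent s : consensual f s ->
  stacked_obj (outer_update f M K alpha s).1 <=
  stacked_obj s.1 - alpha * K%:R / 2 * l2norm s.2 ^+ 2.
Proof.
move=> [E1 E2]; have [-> _] := outer_updateE f alpha s K_gt0.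
have := local_drift s (leqnn K); set y := iter _ _ _.
set b := alpha * K%:R; set V := l2norm s.2 => drift.
set d := M *m y.1 - s.1.
have V0 : 0 <= V := l2norm_ge0 s.2.
have b0 : 0 <= b by rewrite mulr_ge0 // ltW.
have Ms2 : M *m s.2 = s.2 by rewrite E2 averaging_idem.
have dE : d + b *: s.2 = M *m (y.1 - s.1 + b *: s.2).
  by rewrite mulmxDr mulmxBr -scalemxAr -E1 Ms2.
have d1 : l2norm (d + b *: s.2) <= b * V / 4.
  by rewrite dE; apply: le_trans drift; exact: l2norm_averaging_le.
have d2 : l2norm d <= b * V * (5 / 4).
  rewrite -[d](addrK (b *: s.2)); apply: (le_trans (l2normD_le _ _)).
  by rewrite l2normN l2normZ ger0_norm // -/V; lra.
(* The displacement d lies in the range of the symmetric projection M, so only the averaged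
   gradient, which is the tracker, is seen by it. *)
have d3 : dotmx (stacked_grad f s.1) d = dotmx s.2 d.
  rewrite [in RHS]E2 dotmx_averaging; congr dotmx.
  by rewrite mulmxBr -E1 averaging_idem.
have d4 : dotmx s.2 d <= - (3 / 4) * b * V ^+ 2.
  have -> : dotmx s.2 d = dotmx s.2 (d + b *: s.2) - b * V ^+ 2.
    by rewrite [in RHS]dotmxDr dotmxZr l2norm_sqr addrK.
  have := le_trans (dotmx_le s.2 _) (ler_wpM2l V0 d1); rewrite -/V; lra.
have d5 : L * l2norm d ^+ 2 <= b * V ^+ 2 / 4.
  have h : l2norm d ^+ 2 <= (b * V * (5 / 4)) ^+ 2.
    have ? : 0 <= b * V * (5 / 4) by have := mulr_ge0 b0 V0; lra.
    by rewrite ler_pXn2r ?nnegrE ?l2norm_ge0.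
  have bL : L * b <= 8^-1 by rewrite mulrA (mulrC L).
  have bV : 0 <= b * V ^+ 2 by rewrite mulr_ge0 ?sqr_ge0.
  have := ler_wpM2l (ltW L_gt0) h; have := ler_wpM2r bV bL; lra.
have := stacked_descent s.1 d; rewrite d3 addrC subrK.
lra.
Qed.

Lemma averaging_merit_rate x0 : merit_rate f (iterates f M K alpha x0).
Proof.
case: (f_smooth) => _ _ _ [lb lbP].
(* The sequence is shifted by one because consensus holds only after the first mixing. *)
pose s t := iterates f M K alpha x0 t.+1.
have cons t : consensual f (s t) by exact: iterates_consensual.
have b0 : 0 < alpha * K%:R / 2 by rewrite !mulr_gt0 // ltr0n.
set b := alpha * K%:R / 2 in b0.
have s_lb t : n%:R * lb <= stacked_obj (s t).1.
  have [E1 _] := cons t; pose i0 := Ordinal n_gt0.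
  have -> : stacked_obj (s t).1 = n%:R * global_obj f (row i0 (s t).1).
    rewrite /global_obj mulrA divff ?mul1r ?pnatr_eq0 -?lt0n //.
    by apply: eq_bigr => i _; rewrite E1 !row_averaging.
  by rewrite ler_wpM2l ?ler0n //; apply: lbP; exists (row i0 (s t).1).
(* Were the merit above C / T at all times up to T, the T decreases would add up to the whole room
   above the lower bound plus 1; the added 1 makes this a contradiction. *)
exists ((stacked_obj (s 0%N).1 - n%:R * lb + 1) / b) => T T0.
apply: contrapT => H.
set C := _ / b in H.
have big t : (t < T)%N -> C / T%:R < l2norm (s t).2 ^+ 2.
  move=> tT; rewrite -(merit_consensual n_gt0 (cons t)) ltNge.
  by apply/negP => h; apply: H; exists t.+1.
have decr t : (t <= T)%N ->
    stacked_obj (s t).1 <= stacked_obj (s 0%N).1 - t%:R * (b * (C / T%:R)).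
  elim: t => [|t IH] tT; first by rewrite mul0r subr0.
  apply: (le_trans (outer_update_descent (cons t))); rewrite -/b -natr1.
  have := IH (ltnW tT); have := ler_wpM2l (ltW b0) (ltW (big _ tT)); lra.
have := le_trans (s_lb T) (decr _ (leqnn T)).
have -> : T%:R * (b * (C / T%:R)) = stacked_obj (s 0%N).1 - n%:R * lb + 1.
  by rewrite /C; field; rewrite pnatr_eq0 -lt0n T0 gt_eqF.
lra.
Qed.

End Convergence.

(** * The quadratics a |x|^2 / 2 *)

Section ScaledSquare.
Variables (R : realType) (p : nat).
Implicit Types (a : R) (x y v : 'rV[R]_p).

Definition scaled_square a x : R := a / 2 * dotmx x x.

(** The difference quotient is exactly a <x, v> + h a |v|^2 / 2 for nonzero h. *)
Lemma derive_scaled_square a x v : 'D_v (scaled_square a) x = a * dotmx x v.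
Proof.
apply: cvg_lim => //.
have : (fun h : R => a * dotmx x v + h * scaled_square a v) @ 0^' -->
    a * dotmx x v + 0 * scaled_square a v.
  apply: cvg_within_filter; apply: cvgD; first exact: cvg_cst.
  by apply: cvgMl; exact: cvg_id.
rewrite mul0r addr0; apply: cvg_trans; apply: near_eq_cvg.
near=> h.
have h0 : h != 0 by near: h; exact: nbhs_dnbhs_neq.
rewrite /= /scaled_square dotmxDl !dotmxDr !dotmxZl !dotmxZr (dotmxC v x).
by rewrite /GRing.scale /=; field.
Unshelve. all: by end_near.
Qed.

Lemma grad_scaled_square a x : grad (scaled_square a) x = a *: x.
Proof.
apply/rowP => j; rewrite !mxE derive_scaled_square dotmxE big_ord1.
congr (_ * _).
rewrite (bigD1 j) //= big1 ?mxE ?eqxx ?mulr1 ?addr0 // => k kj.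
by rewrite mxE (negPf kj) andbF mulr0.
Qed.

Lemma scaled_square_quadratic a : quadratic (scaled_square a).
Proof.
exists (a / 2)%:M, 0, 0 => x.
rewrite mul_mx_scalar -scalemxAl [X in X + _ + _]mxE mulmx0.
rewrite [X in _ + X + _]mxE !addr0.
by rewrite /scaled_square /dotmx /mxtrace big_ord1.
Qed.

Lemma scaled_square_ge0 a x : 0 <= a -> 0 <= scaled_square a x.
Proof. by move=> a0; rewrite mulr_ge0 ?dotmx_sqr_ge0 ?divr_ge0. Qed.

Lemma scaled_square_convex a : 0 <= a ->
  convex_function [set: 'rV[R]_p] (scaled_square a).
Proof.
move=> a0 t x y _ _.
change (scaled_square a (t%:num *: x + (1 - t%:num) *: y) <=
  t%:num * scaled_square a x + (1 - t%:num) * scaled_square a y).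
rewrite -subr_ge0 (_ : _ - _ =
    t%:num * (1 - t%:num) * scaled_square a (x - y)); last first.
  rewrite /scaled_square.
  rewrite !(dotmxDl, dotmxDr, dotmxZl, dotmxZr, dotmxNl, dotmxNr) (dotmxC y x).
  by field.
by rewrite !mulr_ge0 ?subr_ge0 ?dotmx_sqr_ge0.
Qed.

Lemma scaled_square_lip a L : 0 <= a <= L -> lipschitz_grad L (scaled_square a).
Proof.
move=> /andP[a0 aL] x y; rewrite !grad_scaled_square -scalerBr l2normZ.
by rewrite ger0_norm // ler_wpM2r ?l2norm_ge0.
Qed.

End ScaledSquare.

(** * Exact dynamics of the scheme on scaled squares *)

Section ScaledSquareDynamics.
Variables (R : realType) (n p : nat) (a : 'I_n -> R) (alpha : R) (K : nat).
Hypotheses (n_gt0 : (0 < n)%N) (K_gt0 : (0 < K)%N).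
Implicit Types (s : 'M[R]_(n, p) * 'M[R]_(n, p)) (i : 'I_n).
Local Notation M := (averaging R n).
Let f i : 'rV[R]_p -> R := scaled_square (a i).

(** Length covered in k local steps at curvature c, per unit of initial tracker. The geometric sum
    is left unevaluated so that c = 0 is included. *)
Definition travel (c : R) (k : nat) : R :=
  alpha * \sum_(j < k) (1 - alpha * c) ^+ j.

Definition mean (u : 'I_n -> R) : R := n%:R^-1 * \sum_i u i.

Definition outer_factor : R := 1 - mean a * mean (fun i => travel (a i) K).

Lemma mul_travel c k : c * travel c k = 1 - (1 - alpha * c) ^+ k.
Proof.
rewrite -[RHS]opprB subrX1 /travel; set S := \sum_(_ < _) _.
by rewrite (addrAC 1) subrr add0r mulNr opprK mulrCA mulrA.
Qed.

Lemma row_scaled_square_grad x i : row i (stacked_grad f x) = a i *: row i x.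
Proof. by rewrite row_stacked_grad grad_scaled_square. Qed.

Lemma row_iter_local_update k s i :
  let s' := iter k (local_update f alpha) s in
  row i s'.1 = row i s.1 - travel (a i) k *: row i s.2 /\
  row i s'.2 = (1 - alpha * a i) ^+ k *: row i s.2.
Proof.
elim: k => [|k [IH1 IH2]] /=.
  by rewrite /travel big_ord0 mulr0 scale0r subr0 expr0 scale1r.
set s' := iter _ _ _ in IH1 IH2 *.
have E1 : row i (s'.1 - alpha *: s'.2) = row i s'.1 - alpha *: row i s'.2.
  by apply/rowP => j; rewrite !mxE.
split.
  rewrite E1 IH1 IH2 scalerA -addrA -opprD -scalerDl.
  by rewrite /travel big_ord_recr /= mulrDr.
have -> : row i (s'.2 + stacked_grad f (s'.1 - alpha *: s'.2)
      - stacked_grad f s'.1) =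
    row i s'.2 + a i *: (row i s'.1 - alpha *: row i s'.2) - a i *: row i s'.1.
  by rewrite -E1 -!row_scaled_square_grad; apply/rowP => j; rewrite !mxE.
rewrite exprS -scalerA -IH2; apply/rowP => j; rewrite !mxE; ring.
Qed.

(** The first outer iteration is treated apart, since the initial nodes need not agree: each tracker
    starts as the node's own gradient, so each node runs K steps of plain gradient descent before
    the mixing. *)
Lemma row_iterates1 x0 i :
  row i (iterates f M K alpha x0 1).1 =
  n%:R^-1 *: \sum_j (1 - alpha * a j) ^+ K *: row j x0.
Proof.
have [-> _] := outer_updateE f alpha (x0, stacked_grad f x0) K_gt0.
rewrite row_averaging; congr (_ *: _); apply: eq_bigr => j _.
have [-> _] := row_iter_local_update K (x0, stacked_grad f x0) j.
rewrite row_scaled_square_grad scalerA mulrC mul_travel.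
by rewrite -[X in X - _]scale1r -scalerBl opprB addrC subrK.
Qed.

Lemma row_consensual s i j : consensual f s -> row i s.1 = row j s.1.
Proof. by move=> [-> _]; rewrite !row_averaging. Qed.

Lemma row_consensual_grad s i : consensual f s ->
  row i s.2 = mean a *: row i s.1.
Proof.
move=> cs; have [_ ->] := cs; rewrite row_averaging -scalerA; congr (_ *: _).
rewrite scaler_suml; apply: eq_bigr => j _.
by rewrite row_scaled_square_grad (row_consensual j i cs).
Qed.

Lemma row_outer_update s i : consensual f s ->
  row i (outer_update f M K alpha s).1 = outer_factor *: row i s.1.
Proof.
move=> cs; have [-> _] := outer_updateE f alpha s K_gt0.
rewrite row_averaging.
under eq_bigr => j _.
  have [-> _] := row_iter_local_update K s j.
  rewrite (row_consensual_grad _ cs) (row_consensual j i cs) scalerA.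
  rewrite -[X in X - _]scale1r -scalerBl.
  over.
rewrite -scaler_suml scalerA; congr (_ *: _).
rewrite sumrB sumr_const card_ord mulrBr mulVf ?pnatr_eq0 -?lt0n //.
by rewrite /outer_factor -mulr_suml mulrA mulrC.
Qed.

Lemma row_iterates x0 t i :
  row i (iterates f M K alpha x0 t.+1).1 =
  outer_factor ^+ t *: row i (iterates f M K alpha x0 1).1.
Proof.
elim: t => [|t IH]; first by rewrite scale1r.
rewrite exprS -scalerA -IH -row_outer_update //.
exact: iterates_consensual.
Qed.

Lemma global_obj_scaled_square x :
  global_obj f x = scaled_square (mean a) x.
Proof.
by rewrite /global_obj /f /scaled_square -!mulr_suml !mulrA.
Qed.

Section Divergence.
Variables (L : R) (i0 : 'I_n) (e : 'rV[R]_p) (u : 'I_n -> R).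
Hypotheses (L_gt0 : 0 < L) (a_bnd : forall i, 0 <= a i <= L) (a_i0 : a i0 = L).
Hypotheses (e_gt0 : 0 < l2norm e) (u_ge1 : forall i, 1 <= u i).
Hypothesis u_mean : 2^-1 <= `|mean (fun i => (1 - alpha * a i) ^+ K * u i)|.
Hypothesis expanding : 1 < `|outer_factor|.
Let x0 : 'M[R]_(n, p) := \matrix_i (u i *: e).
Let s := iterates f M K alpha x0.
Let r : R := `|outer_factor|.
(** By [u_mean] the iterate at t = 1 has norm at least |e| / 2 = C r, and every later iteration
    multiplies it by r. At t = 0 the bound C <= |e| comes from [u_ge1] and r >= 1. *)
Let C : R := l2norm e / (2 * r).

Let C_gt0 : 0 < C.
Proof. by rewrite divr_gt0 ?mulr_gt0 // (lt_trans ltr01). Qed.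

Let n_gt0R : 0 < n%:R :> R.
Proof. by rewrite ltr0n. Qed.

Lemma mean_gt0 : 0 < mean a.
Proof.
rewrite mulr_gt0 ?invr_gt0 // (bigD1 i0) //= a_i0 ltr_pwDl //.
by apply: sumr_ge0 => i _; case/andP: (a_bnd i).
Qed.

Lemma mean_le : mean a <= L.
Proof.
rewrite ler_pdivrMl // mulrC mulr_natr -[n in _ *+ n]card_ord -sumr_const.
by apply: ler_sum => i _; case/andP: (a_bnd i).
Qed.

Lemma scaled_square_problem : convex_quadratic_problem L f.
Proof.
split=> [i|i|i|].
- exact: scaled_square_quadratic.
- by apply: scaled_square_convex; case/andP: (a_bnd i).
- exact: scaled_square_lip.
- exists 0 => _ [x _ <-]; rewrite global_obj_scaled_square.
  by rewrite scaled_square_ge0 // ltW // mean_gt0.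
Qed.

Lemma scaled_square_growth t i : C * r ^+ t <= l2norm (row i (s t).1).
Proof.
have r1 : 1 <= r by exact: ltW.
case: t => [|t].
  rewrite expr0 mulr1 rowK l2normZ ger0_norm ?(le_trans _ (u_ge1 i)) //.
  apply: (@le_trans _ _ (l2norm e)); last by rewrite ler_peMl ?l2norm_ge0.
  rewrite /C ler_pdivrMr; last by rewrite mulr_gt0 // (lt_trans ltr01).
  by rewrite ler_peMr ?l2norm_ge0 //; lra.
rewrite row_iterates l2normZ normrX exprS mulrA [leLHS]mulrC.
rewrite ler_wpM2l ?exprn_ge0 ?(le_trans ler01 r1) //.
have -> : C * r = l2norm e / 2.
  by rewrite /C; field; rewrite gt_eqF // (lt_trans ltr01).
rewrite row_iterates1.
under eq_bigr => j _ do rewrite rowK scalerA.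
by rewrite -scaler_suml scalerA l2normZ mulrC ler_wpM2r ?l2norm_ge0.
Qed.

Lemma scaled_square_diverges : diverges_geometrically f s.
Proof.
have F0 : global_obj f 0 = 0.
  by rewrite global_obj_scaled_square /scaled_square dotmx0l mulr0.
exists 0; split => [y|y ymin|].
- rewrite F0 global_obj_scaled_square.
  by rewrite scaled_square_ge0 // ltW // mean_gt0.
- apply: l2norm_eq0; apply/eqP.
  rewrite -sqrf_eq0 l2norm_sqr eq_le dotmx_sqr_ge0.
  have := ymin 0; rewrite F0 global_obj_scaled_square /scaled_square.
  by rewrite andbT pmulr_rle0 // divr_gt0 // mean_gt0.
- exists C, r; split => // t i; rewrite subr0; exact: scaled_square_growth.
Qed.

(** Needed to refute [merit_rate], which controls the tracker and not the distance to the minimizer.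
    The tracker at node i0 is L x at t = 0 and [mean a] times x afterwards, hence at least [mean a]
    times a quantity bounded below by C. *)
Lemma scaled_square_merit : exists2 m, 0 < m & forall t, m <= merit (s t).
Proof.
have r1 : 1 <= r by exact: ltW.
have C0 := C_gt0; have a0 := mean_gt0.
exists ((mean a * C) ^+ 2) => [|t]; first by rewrite exprn_gt0 // mulr_gt0.
apply: (@le_trans _ _ (l2norm (s t).2 ^+ 2)); last first.
  by rewrite /merit -addrA lerDl addr_ge0 // sqr_ge0.
rewrite ler_pXn2r ?nnegrE ?l2norm_ge0 ?(ltW (mulr_gt0 _ _)) //.
apply: le_trans (l2norm_row_le _ i0).
have h c : mean a <= c -> row i0 (s t).2 = c *: row i0 (s t).1 ->
    mean a * C <= l2norm (row i0 (s t).2).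
  move=> ac ->; have c0 := lt_le_trans a0 ac.
  rewrite l2normZ (ger0_norm (ltW c0)).
  apply: ler_pM => //; [exact: ltW|exact: ltW|].
  apply: le_trans (scaled_square_growth t i0).
  by rewrite ler_peMr ?exprn_ege1 // ltW.
case: t h => [|t] h.
  by apply: (h L) => //; [exact: mean_le|rewrite row_scaled_square_grad a_i0].
apply: (h (mean a)) => //; apply: row_consensual_grad.
exact: iterates_consensual.
Qed.

End Divergence.
End ScaledSquareDynamics.

(** * Divergent problems on two nodes *)

Section TwoNodes.
Variable R : realType.

Lemma divergent_problem (L : R) (p K : nat) (alpha : R) :
  0 < L -> (0 < p)%N -> (0 < K)%N -> 8 / (L * K%:R) < alpha ->
  exists f : 'I_2 -> 'rV[R]_p -> R,
    convex_quadratic_problem L f /\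
    exists x0 : 'M[R]_(2, p),
      let s := iterates f (averaging R 2) K alpha x0 in
      diverges_geometrically f s /\
      exists2 m, 0 < m & forall t, m <= merit (s t).
Proof.
move=> L0 p0 K0 alphaK.
have LK0 : 0 < L * K%:R by rewrite mulr_gt0 ?ltr0n.
have alpha0 : 0 < alpha by apply: lt_trans alphaK; rewrite divr_gt0.
move: alphaK; rewrite ltr_pdivrMr // => alphaK.
pose e : 'rV[R]_p := const_mx 1.
have e0 : 0 < l2norm e.
  rewrite lt0r l2norm_ge0 andbT; apply/eqP => /l2norm_eq0/rowP/(_ (Ordinal p0)).
  by rewrite !mxE => /eqP; rewrite oner_eq0.
have mean2 (v : 'I_2 -> R) : mean v = (v 0 + v 1) / 2.
  rewrite /mean !big_ord_recl big_ord0 addr0 mulrC.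
  by congr ((_ + v _) / _); exact: val_inj.
suff [a [u [a_bnd a1 u1 um ex]]] : exists a u : 'I_2 -> R,
    [/\ forall i, 0 <= a i <= L, a 1 = L, forall i, 1 <= u i,
        2^-1 <= `|mean (fun i => (1 - alpha * a i) ^+ K * u i)| &
        1 < `|outer_factor a alpha K|].
  exists (fun i => scaled_square (a i)); split.
    exact: scaled_square_problem a1.
  exists (\matrix_i (u i *: e)); split.
    exact: scaled_square_diverges a1 _ _ _ _.
  exact: scaled_square_merit a1 _ _ _ _.
have half (c : R) : (c + c) / 2 = c by lra.
have [aL|aL] := ltP 2 (alpha * L).
  have q1 : 1 < `|(1 - alpha * L) ^+ K|.
    by rewrite normrX exprn_egt1 -?lt0n // ltr0_norm; lra.
  exists (fun=> L), (fun=> 1); split=> //.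
  - by move=> _; rewrite lexx ltW.
  - by rewrite mean2 /= mulr1 half; lra.
  - rewrite /outer_factor !mean2 /= !half.
    by rewrite mul_travel opprB addrC subrK.
have q1 : `|(1 - alpha * L) ^+ K| <= 1.
  rewrite normrX exprn_ile1 // ler_norml.
  have := mulr_gt0 alpha0 L0; lra.
set q := _ ^+ K in q1; move: q1; rewrite ler_norml => /andP[q_ge q_le].
(* The flat node keeps its initial vector 2e and the curved one contributes q e with q >= -1, so the
   first average is at least e / 2; equal initial vectors could cancel. *)
exists (fun i => if i == 0 then 0 else L), (fun i => if i == 0 then 2 else 1).
split.
- by move=> i; case: ifP => _; rewrite lexx ltW.
- by [].
- by move=> i; case: ifP => _; lra.
- by rewrite mean2 /= mulr0 subr0 expr1n -/q ger0_norm; lra.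
have t0 : travel alpha 0 K = alpha * K%:R.
  rewrite /travel mulr0 subr0; under eq_bigr => j _ do rewrite expr1n.
  by rewrite sumr_const card_ord.
have tL : L * travel alpha L K = 1 - q by exact: mul_travel.
rewrite /outer_factor !mean2 /= t0 ltr0_norm; lra.
Qed.

Lemma guaranteed_stepsize_le (L : R) (p K : nat) (alpha : R) :
  0 < L -> (0 < p)%N -> (0 < K)%N ->
  guarantees (@merit_rate R 2 p) (convex_quadratic_problem L)
    (averaging R 2) K alpha \/
  guarantees (@minimizer_cvg R 2 p) (convex_quadratic_problem L)
    (averaging R 2) K alpha ->
  alpha <= 8 / (L * K%:R).
Proof.
move=> L0 p0 K0 guar; rewrite leNgt; apply/negP.
move=> /(divergent_problem L0 p0 K0).
move=> [f [fP [x0 /= [fdiv [m m0 merit_ge]]]]].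
case: guar => [/(_ f fP x0)[C HC]|/(_ f fP x0)[z zmin zcvg]].
  (* A horizon beyond C / m forces the merit below its positive lower bound m. *)
  have CN := archi_boundP (normr_ge0 (C / m)); set N := Num.bound _ in CN.
  move/(le_lt_trans (ler_norm _)): CN => CN.
  have [t _ tC] := HC N.+1 isT.
  have := le_trans (merit_ge t) tC; rewrite ler_pdivlMr ?ltr0n //.
  move: CN; rewrite ltr_pdivrMr // -natr1; nra.
have [z' [_ zuniq [C [r [C0 r1 Cr]]]]] := fdiv.
(* Uniqueness of the minimizer identifies the limit with the point from which the iterates move
   away. *)
rewrite -(zuniq z zmin) in Cr.
have /cvgrPdist_lt/(_ _ C0) := zcvg 0.
move=> /filter_ex[t]; rewrite sub0r normrN ger0_norm ?l2norm_ge0 //.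
apply/negP; rewrite -leNgt; apply: le_trans (Cr t 0).
by rewrite ler_peMr ?exprn_ege1 // ltW.
Qed.

End TwoNodes.

(** * Mixing matrices on two nodes *)

Section TwoNodeMixing.
Variable R : realType.

Lemma det_mx22 (S : comPzRingType) (A : 'M[S]_2) :
  \det A = A 0 0 * A 1 1 - A 0 1 * A 1 0.
Proof.
rewrite (expand_det_row _ 0) !big_ord_recl big_ord0 addr0 /cofactor.
rewrite !det_mx11 !mxE expr0 mul1r expr1 mulN1r mulrN.
by congr (A _ _ * A _ _ - A _ _ * A _ _); exact: val_inj.
Qed.

Lemma averaging_mixing : mixing_matrix (averaging R 2).
Proof.
exists (fun i j => i != j); split; split.
- by move=> i j; rewrite eq_sym.
- by move=> i; rewrite eqxx.
- move=> i j; have [->|ij] := eqVneq i j; first exact: connect0.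
  exact: connect1.
- by apply/matrixP => i j; rewrite !mxE.
- by move=> i j; rewrite mxE.
- move=> i; under eq_bigr => j _ do rewrite mxE.
  by rewrite sumr_const card_ord -(mulr_natr _^-1) mulVf ?pnatr_eq0.
- by move=> i j; rewrite mxE orbN invr_gt0 ltr0n.
Qed.

Lemma averaging_second_eigenvalue :
  second_eigenvalue_magnitude (averaging R 2) 0.
Proof.
exists [:: 1; 0]; split=> /=.
- rewrite /char_poly det_mx22 !mxE /= big_cons big_cons big_nil.
  have -> : 1%:P = (2^-1)%:P + (2^-1)%:P :> {poly R}.
    by rewrite -polyCD; congr polyC; lra.
  by rewrite mulr1n mulr0n; ring.
- by rewrite normr0 normr_ge0.
- by rewrite normr0.
Qed.

(** A zero eigenvalue makes the determinant vanish. A symmetric stochastic matrix of size 2 with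
    off-diagonal entry w has determinant (1 - w)^2 - w^2 = 1 - 2w, so w = 1/2. *)
Lemma second_eigenvalue0_averaging (W : 'M[R]_2) :
  mixing_matrix W -> second_eigenvalue_magnitude W 0 -> W = averaging R 2.
Proof.
move=> [e [_ [Wsym _ W1 _]]] [l [charW _ l1]].
have sl : size l = 2.
  by have := size_char_poly W; rewrite charW size_prod_XsubC => -[].
have detW : \det W = 0.
  have := char_poly_det W; rewrite charW sqrrN expr1n mul1r => <-.
  case: l sl l1 {charW} => [|b [|c [|//]]] //= _ /esym/eqP.
  rewrite normr_eq0 => /eqP ->.
  by rewrite !big_cons big_nil mulr1 subr0 mulrC coefXM.
have W01 : W 1 0 = W 0 1 by rewrite -[in RHS]Wsym mxE.
have rowW (i : 'I_2) : W i 0 + W i 1 = 1.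
  rewrite -(W1 i) !big_ord_recl big_ord0 addr0.
  by congr (W _ _ + W _ _); exact: val_inj.
have h0 := rowW 0; have h1 := rowW 1; rewrite W01 in h1.
move: detW; rewrite det_mx22 W01 => d.
have {}d : W 0 1 = 2^-1 by nra.
have i2 (i : 'I_2) : i = 0 \/ i = 1.
  by case: i => [[|[|//]] ?]; [left|right]; exact: val_inj.
apply/matrixP => i j; rewrite mxE.
case: (i2 i) => ->; case: (i2 j) => ->; rewrite ?W01; lra.
Qed.

End TwoNodeMixing.

(** * Uniform stepsize bounds and the tight scaling *)

Lemma averaging_guarantees (R : realType) (L : R) (p K : nat) (alpha : R) :
  0 < L -> (0 < K)%N -> 0 < alpha -> alpha <= (8 * L)^-1 / K%:R ->
  guarantees (@merit_rate R 2 p) (smooth_problem L) (averaging R 2) K alpha.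
Proof.
move=> L0 K0 a0 aK f fP x0; apply: averaging_merit_rate fP x0 => //.
move: aK; rewrite ler_pdivlMr ?ltr0n // -div1r ler_pdivlMr ?mulr_gt0 //; lra.
Qed.

Lemma stepsize_bound_uniform (R : realType) (L sigma : R) :
  0 < L -> 0 < sigma < 1 -> exists2 c : R, 0 < c &
  forall (s : R) (K : nat) (alpha : R), 0 <= s <= sigma -> (0 < K)%N ->
    alpha <= c / K%:R -> stepsize_bound L 2 s K alpha.
Proof.
move=> L0 /andP[s0 s1]; set g := 1 - sigma ^+ 2.
have g0 : 0 < g by rewrite /g; nra.
have g1 : g <= 1 by rewrite /g; nra.
(* B dominates the inner parenthesis of the bound for every s <= sigma: denominators use sigma,
   while s^2 and 1 - s^2 in numerators are replaced by 1. *)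
pose B := L / 2 + 2 * L ^+ 2 / (2 * g)
  + 64 * L ^+ 2 / (2 * g ^+ 3) + 3 * 2 / 16.
have L2 : 0 <= L ^+ 2 by exact: sqr_ge0.
have B0 : 0 < B.
  rewrite /B; have ? : 0 <= 2 * L ^+ 2 / (2 * g).
    by rewrite !mulr_ge0 ?invr_ge0 ?mulr_ge0 // ltW.
  have ? : 0 <= 64 * L ^+ 2 / (2 * g ^+ 3).
    by rewrite !mulr_ge0 ?invr_ge0 ?mulr_ge0 ?exprn_ge0 // ltW.
  lra.
have D0 : 0 < L / 2 + 16 * B by lra.
(* The first entry uses sqrt 3 >= 1. In the second, K >= 1 lets K (L/2 + 16 B) dominate the
   denominator, and the factor 2 yields the strict inequality. *)
exists (Num.min (4 * L)^-1 (2 * (L / 2 + 16 * B))^-1).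
  by rewrite lt_min !invr_gt0 !mulr_gt0.
move=> s K alpha /andP[sge sle] K0 aK.
have K1 : 1 <= K%:R :> R by rewrite ler1n.
have K0R : 0 < K%:R :> R by rewrite ltr0n.
move: aK; rewrite ler_pdivlMr // le_min => /andP[a1 a2].
split.
  rewrite ler_pdivlMr; last by rewrite !mulr_gt0.
  have ? : 1 <= Num.sqrt 3 :> R by rewrite -[leLHS]sqrtr1 ler_wsqrtr // ler1n.
  move: a1; rewrite -[_^-1]mul1r ler_pdivlMr ?mulr_gt0 //; lra.
have gs : g <= 1 - s ^+ 2 by rewrite /g lerD2l lerN2 ler_pXn2r // nnegrE // ltW.
have gs0 : 0 < 1 - s ^+ 2 by exact: lt_le_trans gs.
set E := _ + _ + _ + _.
have E0 : 0 <= E.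
  by rewrite /E !addr_ge0 // ?divr_ge0 ?mulr_ge0 ?exprn_ge0 // ltW.
have EB : E <= B.
  rewrite /E /B; apply: lerD; [apply: lerD; [apply: lerD => // |]|].
  - rewrite ler_wpM2l ?mulr_ge0 ?(ltW L0) // lef_pV2 ?posrE ?mulr_gt0 //.
    by rewrite ler_pM2l.
  - have s2 : 0 <= s ^+ 2 <= 1.
      by rewrite sqr_ge0 exprn_ile1 // (le_trans sle) // ltW.
    apply: ler_pM; first by have := L2; nra.
    + by rewrite invr_ge0 mulr_ge0 // exprn_ge0 // ltW.
    + by rewrite ler_wpM2r // ler_piMr //; case/andP: s2.
    + rewrite lef_pV2 ?posrE ?mulr_gt0 ?exprn_gt0 // ler_pM2l //.
      by rewrite ler_pXn2r ?nnegrE // ltW.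
  - rewrite ler_wpM2r ?invr_ge0 // ler_piMr //; have := sqr_ge0 s; lra.
rewrite ltr_pdivlMr; last by have := mulr_ge0 (ltW K0R) E0; lra.
have [a_le|a_gt] := lerP alpha 0.
  have := mulr_ge0 (ltW K0R) E0; nra.
have : alpha * K%:R * (2 * (L / 2 + 16 * B)) <= 1.
  by move: a2; rewrite -[_^-1]mul1r ler_pdivlMr ?mulr_gt0.
have : alpha * (L / 2 + 16 * K%:R * E) <= alpha * K%:R * (L / 2 + 16 * B).
  rewrite -[leRHS]mulrA (ler_wpM2l (ltW a_gt)) //.
  have := ler_wpM2l (ltW K0R) EB; nra.
lra.
Qed.

(** A guarantee over a family containing exact averaging specializes to exact averaging, so the
    upper limit on stepsizes is shared by all such families and only sufficiency depends on the
    family. *)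
Lemma tight_scaling (R : realType) (L c : R) (Ws : set 'M[R]_2) :
  0 < L -> 0 < c -> Ws (averaging R 2) ->
  (forall (p K : nat) (alpha : R) W, (0 < p)%N -> (0 < K)%N -> 0 < alpha ->
     alpha <= c / K%:R -> Ws W ->
     guarantees (@merit_rate R 2 p) (smooth_problem L) W K alpha) ->
  stepsize_scaling_tight L Ws.
Proof.
move=> L0 c0 WsM suff; exists c, (8 / L); split=> // [|p p0].
  by rewrite divr_gt0.
split=> [K alpha K0 a0 ac W WsW|K alpha K4 a0 guar]; first exact: suff.
rewrite -mulrA -invfM; apply: (guaranteed_stepsize_le L0 p0).
  by apply: leq_trans K4.
by left; exact: guar.
Qed.

Theorem proposition3p5 (R : realType) :
  [/\ forall (L : R) (p Kg : nat) (alpha : R),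
        0 < L -> (0 < p)%N -> (4 <= Kg)%N -> 8 / (L * Kg%:R) < alpha ->
        exists f : 'I_2 -> 'rV[R]_p -> R,
          convex_quadratic_problem L f /\
          exists x0 : 'M[R]_(2, p),
            diverges_geometrically f
              (iterates f (averaging R 2) Kg alpha x0),
      exists2 c : R, 0 < c &
        forall (L : R) (p Kg : nat) (alpha : R),
          0 < L -> (0 < p)%N -> (4 <= Kg)%N -> 0 < alpha ->
          guarantees (@merit_rate R 2 p) (convex_quadratic_problem L)
            (averaging R 2) Kg alpha \/
          guarantees (@minimizer_cvg R 2 p) (convex_quadratic_problem L)
            (averaging R 2) Kg alpha ->
          alpha <= c / (L * Kg%:R),
      forall L : R, 0 < L ->
        stepsize_scaling_tight L [set averaging R 2] &
      sufficient_stepsize_bound R ->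
      forall L sigma : R, 0 < L -> 0 < sigma < 1 ->
        stepsize_scaling_tight L
          [set W | mixing_matrix W /\
             exists2 s, second_eigenvalue_magnitude W s & s <= sigma]].
Proof.
split=> [L p K alpha L0 p0 K4 aK||L L0|suff L sigma L0 sigma01].
- have [f [fP [x0 [fdiv _]]]] :=
    divergent_problem L0 p0 (leq_trans (isT : 0 < 4)%N K4) aK.
  by exists f; split=> //; exists x0.
- exists 8 => // L p K alpha L0 p0 K4 _; apply: guaranteed_stepsize_le => //.
  exact: leq_trans K4.
- apply: (@tight_scaling _ _ (8 * L)^-1) => // [|p K alpha W p0 K0 a0 aK ->].
    by rewrite invr_gt0 mulr_gt0.
  exact: averaging_guarantees.
- have [c c0 cP] := stepsize_bound_uniform L0 sigma01.
  (* The constant c serves the assumed bound when the second eigenvalue is nonzero, and 1 / (8 L)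
     the case of exact averaging. *)
  apply: (@tight_scaling _ _ (Num.min c (8 * L)^-1)) => //.
  + by rewrite lt_min c0 invr_gt0 mulr_gt0.
  + split; first exact: averaging_mixing.
    exists 0; first exact: averaging_second_eigenvalue.
    by case/andP: sigma01 => /ltW.
  + move=> p K alpha W p0 K0 a0.
    rewrite ler_pdivlMr ?ltr0n // le_min -!ler_pdivlMr ?ltr0n //.
    move=> /andP[ac aL] [Wmix [s Ws s_le]].
    have s_ge0 : 0 <= s by case: Ws => l [_ _ ->].
    have [s0|s0] := eqVneq s 0.
      rewrite s0 in Ws; rewrite (second_eigenvalue0_averaging Wmix Ws).
      exact: averaging_guarantees.
    apply: (suff L 2 p W s) => //.
      rewrite lt0r s0 s_ge0 /=; case/andP: sigma01 => _; exact: le_lt_trans.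
    by apply: cP => //; rewrite s_ge0.
Qed.
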